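(* Let $G = \mathbb{Z}/n_1\mathbb{Z} \oplus \mathbb{Z}/n_2\mathbb{Z} \oplus \cdots \oplus \mathbb{Z}/n_m\mathbb{Z}$ be a finite abelian group of order $n = n_1 n_2 \cdots n_m$ (where $m\ge 1$ and the $n_i$ are positive integers, not necessarily prime powers), let $K$ be a number field contained in the cyclotomic field $\mathbb{Q}(\zeta_n)$, let $H = \mathrm{Gal}(\mathbb{Q}(\zeta_n)/K)$ act on $G$ as described in the context, and let $G\setminus\{0\} = \bigsqcup_{i\in I} Hg_i$ be the decomposition of $G\setminus\{0\}$ into distinct $H$-orbits. Let $S \subseteq G\setminus\{0\}$. Then the Cayley digraph $D(G,S)$ is algebraically integral over $K$ if and only if $S$ is a union of some of the orbits $Hg_i$.
   Context: $\zeta_k$ denotes a primitive $k$-th root of unity. For a group $G$ and a subset $S$ of $G$ not containing the identity, the Cayley digraph $D(G,S)$ has vertex set $G$ and a directed edge from $g$ to $h$ exactly when $hg^{-1}\in S$ (in additive notation, $h-g\in S$). The spectrum of a digraph is the set of eigenvalues of its adjacency matrix. A digraph is called algebraically integral over a number field $K$ if all of its eigenvalues are algebraic integers lying in $K$. Action of $H$ on $G$: each $\sigma\in H = \mathrm{Gal}(\mathbb{Q}(\zeta_n)/K) \subseteq \mathrm{Gal}(\mathbb{Q}(\zeta_n)/\mathbb{Q})\cong(\mathbb{Z}/n\mathbb{Z})^*$ corresponds to an element $a\in(\mathbb{Z}/n\mathbb{Z})^*$ with $\sigma(\zeta_n)=\zeta_n^a$. Then $\sigma$ acts on $\mathbb{Z}/n_i\mathbb{Z}$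 by $\sigma(x) = ax \pmod{n_i}$, and on $G$ by $\sigma(x_1,\dots,x_m) = (\sigma(x_1),\dots,\sigma(x_m))$. The subset $G\setminus\{0\}$ is stable under this action. A union of orbits may be empty. *)

(* Defs.v *)
From HB Require Import structures.
From mathcomp Require Import all_boot all_order all_fingroup all_algebra.
From mathcomp Require Import all_solvable all_field.

Set Implicit Arguments.
Unset Strict Implicit.
Unset Printing Implicit Defensive.

Import GRing.Theory.
Local Open Scope ring_scope.

(* Vertices of a digraph [e] are numbered by [enum_val] to form its adjacency
   matrix; another numbering would give a conjugate matrix. *)
Definition adjacency_mx (R : pzSemiRingType) (V : finType) (e : rel V) :
    'M[R]_#|V| :=
  \matrix_(i, j) (e (enum_val i) (enum_val j))%:R.

Definition spectrum (V : finType) (e : rel V) : {pred algC} :=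
  eigenvalue (adjacency_mx algC e).

(* The number field [K] is a subfield of a finite extension [L] of the
   rationals, which [iota] embeds in the complex algebraic numbers. *)
Definition alg_integral_over (L : fieldExtType rat)
    (iota : {rmorphism L -> algC}) (K : {subfield L})
    (V : finType) (e : rel V) : Prop :=
  forall a : algC, a \in spectrum e ->
    a \in Aint /\ exists2 k : L, k \in K & a = iota k.

Definition cayley_digraph (gT : finGroupType) (S : {set gT}) : rel gT :=
  fun g h => (h * g^-1)%g \in S.

(* The additive group of integers modulo [n], for [n > 0].  Unlike ['Z_n], it
   is the trivial group when [n = 1]. *)
Definition residues (n : nat) : finGroupType := 'I_n.-1.+1.

(* The group law of [residues n] and of the direct sum is addition, but it is
   written multiplicatively, with neutral element [1%g]. *)
Definition direct_sum (m : nat) (n_ : 'I_m -> nat) : finGroupType :=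
  {dffun forall i : 'I_m, residues (n_ i)}.

Fact gal_unity_root (L : splittingFieldType rat) (n : nat) (zeta : L)
    (hz : n.-primitive_root zeta) (s : gal_of {:L}) : s zeta ^+ n = 1.
Proof. by rewrite -rmorphXn /= (prim_expr_order hz) rmorph1. Qed.

(* The exponent [a] such that [s zeta = zeta ^+ a]. *)
Definition gal_exp (L : splittingFieldType rat) (n : nat) (zeta : L)
    (hz : n.-primitive_root zeta) (s : gal_of {:L}) : 'I_n :=
  sval (prim_rootP hz (gal_unity_root hz s)).

Lemma gal_expP (L : splittingFieldType rat) (n : nat) (zeta : L)
    (hz : n.-primitive_root zeta) (s : gal_of {:L}) :
  s zeta = zeta ^+ gal_exp hz s.
Proof. exact: svalP (prim_rootP hz (gal_unity_root hz s)). Qed.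

Definition gal_mul (m : nat) (n_ : 'I_m -> nat)
    (L : splittingFieldType rat) (zeta : L)
    (hz : (\prod_i n_ i)%N.-primitive_root zeta)
    (x : direct_sum n_) (s : gal_of {:L}) : direct_sum n_ :=
  [ffun i => inZp (gal_exp hz s * (x : {dffun forall i, residues (n_ i)}) i)
             : residues (n_ i)].

Fact gal_mulE (m : nat) (n_ : 'I_m -> nat)
    (L : splittingFieldType rat) (zeta : L)
    (hz : (\prod_i n_ i)%N.-primitive_root zeta)
    (x : direct_sum n_) (s : gal_of {:L}) (a : nat) :
  s zeta = zeta ^+ a ->
  gal_mul hz x s =
    [ffun i => inZp (a * (x : {dffun forall i, residues (n_ i)}) i)
               : residues (n_ i)].
Proof.
move=> sa; have /eqP := gal_expP hz s; rewrite sa (eq_prim_root_expr hz).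
move=> /eqP ea; apply/ffunP => i; rewrite !ffunE; apply: val_inj => /=.
move: (nat_of_ord (x i)) => k.
have n_gt0 : (0 < n_ i)%N.
  have := prim_order_gt0 hz; rewrite !lt0n; apply: contraNneq => n0.
  by rewrite (bigD1 i) //= n0 mul0n.
have dvd_n : (n_ i %| \prod_j n_ j)%N by rewrite (bigD1 i) //= dvdn_mulr.
rewrite prednK // -modnMml -(modn_dvdm (gal_exp hz s) dvd_n) -ea.
by rewrite modn_dvdm // modnMml.
Qed.

Fact gal_mul1 (m : nat) (n_ : 'I_m -> nat)
    (L : splittingFieldType rat) (zeta : L)
    (hz : (\prod_i n_ i)%N.-primitive_root zeta) :
  gal_mul hz ^~ 1%g =1 id.
Proof.
move=> x; rewrite (@gal_mulE _ _ _ _ hz x 1%g 1) ?gal_id ?expr1 //.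
by apply/ffunP => i; rewrite ffunE mul1n valZpK.
Qed.

Fact gal_mulM (m : nat) (n_ : 'I_m -> nat)
    (L : splittingFieldType rat) (zeta : L)
    (hz : (\prod_i n_ i)%N.-primitive_root zeta)
    (x : direct_sum n_) (s t : gal_of {:L}) :
  gal_mul hz x (s * t)%g = gal_mul hz (gal_mul hz x s) t.
Proof.
rewrite (@gal_mulE _ _ _ _ hz x (s * t)%g (gal_exp hz t * gal_exp hz s)).
  apply/ffunP => i; rewrite !ffunE; apply: val_inj => /=.
  by rewrite modnMmr mulnA.
by rewrite galM ?memvf // (gal_expP hz s) rmorphXn /= (gal_expP hz t) exprM.
Qed.

Canonical gal_action (m : nat) (n_ : 'I_m -> nat)
    (L : splittingFieldType rat) (zeta : L)
    (hz : (\prod_i n_ i)%N.-primitive_root zeta) :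
    {action gal_of {:L} &-> direct_sum n_} :=
  TotalAction (gal_mul1 hz) (gal_mulM hz).

(* Main.v *)
Require Import Defs.
From HB Require Import structures.
From mathcomp Require Import all_boot all_order all_fingroup all_algebra.
From mathcomp Require Import all_solvable all_field.

(* The eigenvalues of [D(G, S)] are the sums over [S] of the characters
   [x |-> zeta ^ (sum_i (n / n_i) y_i x_i)] indexed by [y] in [G].  A Galois
   element [s] maps the sum over [S] to the sum over [s(S)], and by Fourier
   inversion a set is determined by its character sums; so all eigenvalues are
   fixed by [Gal(L / K)], i.e., lie in [K], exactly when [S] is stable under
   the action.  They are always algebraic integers, being sums of roots of
   unity. *)

Set Implicit Arguments.
Unset Strict Implicit.
Unset Printing Implicit Defensive.

Import GRing.Theory.
Local Open Scope ring_scope.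

(** * Character sums and the spectrum of a Cayley digraph *)

Section Spectrum.

Variables (gT : finGroupType) (F : fieldType).

(** Translating the summation variable by [x] multiplies the sum by [chi x]. *)
Lemma sum_character_eq0 (chi : gT -> F) (x : gT) :
  {morph chi : y z / (y * z)%g >-> y * z} -> chi x != 1 -> \sum_y chi y = 0.
Proof.
move=> chiM chix1; apply/eqP; have: (chi x - 1) * (\sum_y chi y) == 0.
  rewrite mulrBl mul1r mulr_sumr [in X in _ - X](reindex_inj (mulgI x)) /=.
  by rewrite -sumrB big1 // => y _; rewrite chiM subrr.
by rewrite mulf_eq0 subr_eq0 (negPf chix1).
Qed.

Definition cayley_value (S : {set gT}) (chi : gT -> F) : F :=
  \sum_(s in S) chi s.

(** The group indexes its own characters, so orthogonality can be used in the index [y] as well. *)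
Variable chi : gT -> gT -> F.

Hypotheses (chiMl : forall x, {morph chi^~ x : y z / (y * z)%g >-> y * z})
  (chiMr : forall y, {morph chi y : x z / (x * z)%g >-> x * z})
  (chi_neq1 : forall x, x != 1%g -> exists y, chi y x != 1)
  (chi_neq0 : forall y x, chi y x != 0)
  (card_neq0 : #|gT|%:R != 0 :> F).

Let chi_1 y : chi y 1%g = 1.
Proof. by apply: (mulfI (chi_neq0 y 1%g)); rewrite -chiMr mulg1 mulr1. Qed.

(** Multiply by [chi y g^-1] and sum over [y]: the term of [x] contains the sum over [y] of
    [chi y (x * g^-1)], which vanishes unless [x = g], so only [f g * #|gT|] remains. *)
Lemma fourier_inj (f : gT -> F) :
  (forall y, \sum_x f x * chi y x = 0) -> forall x, f x = 0.
Proof.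
move=> f0 g; apply: (mulIf card_neq0); rewrite mul0r.
transitivity (\sum_y (\sum_x f x * chi y x) * chi y g^-1%g); last first.
  by rewrite big1 // => y _; rewrite f0 mul0r.
under eq_bigr => y _ do rewrite mulr_suml.
rewrite exchange_big (bigD1 g) //= [X in _ + X]big1 ?addr0 => [|x xg].
  under eq_bigr => y _ do rewrite -mulrA -chiMr mulgV chi_1.
  by rewrite -mulr_sumr sumr_const.
under eq_bigr => y _ do rewrite -mulrA -chiMr.
have [|y chiy] := chi_neq1 (x := (x * g^-1)%g); first by rewrite -eq_mulgV1.
by rewrite -mulr_sumr (sum_character_eq0 (chiMl _) chiy) mulr0.
Qed.

(** Fourier inversion applies to the difference of the two indicator functions. *)
Lemma cayley_value_inj (S T : {set gT}) :
  (forall y, cayley_value S (chi y) = cayley_value T (chi y)) -> S = T.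
Proof.
move=> eqST; apply/setP=> x; apply/eqP.
have /eqP: (x \in S)%:R - (x \in T)%:R = 0 :> F.
  apply: (@fourier_inj (fun x => (x \in S)%:R - (x \in T)%:R)) => y.
  under eq_bigr => z _ do rewrite mulrBl !mulr_natl !mulrb.
  by rewrite sumrB -!big_mkcond /= -/(cayley_value _ _) eqST subrr.
rewrite subr_eq0.
by case: (x \in S) (x \in T) => [] []; rewrite //= ?oner_eq0 // eq_sym oner_eq0.
Qed.

(** The adjacency matrix acts on row vectors as convolution with the indicator of [S], which the
    Fourier transform turns into multiplication by [cayley_value S (chi y)]. A nonzero eigenvector
    has some nonzero Fourier coefficient, and cancelling it gives [a]. *)
Lemma cayley_eigenvalueP (S : {set gT}) (a : F) :
  reflect (exists y, a = cayley_value S (chi y))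
          (eigenvalue (adjacency_mx F (cayley_digraph S)) a).
Proof.
have mulA (u : 'rV[F]_#|gT|) h :
    (u *m adjacency_mx F (cayley_digraph S)) ord0 (enum_rank h)
    = \sum_(s in S) u ord0 (enum_rank (s^-1 * h)%g).
  rewrite mxE (reindex _ (onW_bij _ (@enum_rank_bij gT))) /=.
  under eq_bigr => g _ do rewrite mxE !enum_rankK mulr_natr mulrb.
  rewrite -big_mkcond /= (reindex_inj (inj_comp (mulIg h) invg_inj)) /=.
  by apply: eq_bigl => g; rewrite /cayley_digraph invMg invgK mulKVg.
apply: (iffP eigenvalueP) => [[v vA v_neq0] | [y ->]].
  have [/existsP[y w_neq0] | /existsPn w0] :=
    boolP [exists y, \sum_g v ord0 (enum_rank g) * chi y g != 0]; last first.
    case/negP: v_neq0; apply/eqP/rowP => i; rewrite mxE -(enum_valK i).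
    apply: (@fourier_inj (fun g => v ord0 (enum_rank g))) => y.
    by apply/eqP; rewrite -[_ == _]negbK.
  exists y; apply: (mulIf w_neq0); rewrite mulr_sumr mulr_suml.
  transitivity (\sum_h (\sum_(s in S) v ord0 (enum_rank (s^-1 * h)%g)) * chi y h).
    by apply: eq_bigr => h _; rewrite -mulA vA mxE mulrA.
  under eq_bigr => h _ do rewrite mulr_suml.
  rewrite exchange_big; apply: eq_bigr => s _ /=.
  rewrite (reindex_inj (mulgI s)) mulr_sumr.
  by apply: eq_bigr => h _; rewrite mulKg chiMr mulrCA.
(* The inverse is needed because the convolution evaluates the vector at [s^-1 * h], while the
   eigenvalue must contain [chi y s]. *)
exists (\row_i chi y (enum_val i)^-1%g); last first.
  apply/eqP => /rowP/(_ (enum_rank 1%g))/eqP.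
  by rewrite !mxE (negPf (chi_neq0 _ _)).
apply/rowP => i; rewrite -(enum_valK i) mulA !mxE mulr_suml enum_rankK.
by apply: eq_bigr => s _; rewrite mxE enum_rankK invMg invgK chiMr mulrC.
Qed.

End Spectrum.

(** * The self-duality pairing of the direct sum *)

Section Pairing.

Variables (m : nat) (n_ : 'I_m -> nat) (n_gt0 : forall i, (0 < n_ i)%N).
Variables (F : fieldType) (z : F).
Hypothesis hz : (\prod_i n_ i)%N.-primitive_root z.

Let n := (\prod_i n_ i)%N.

Definition pairing (y x : direct_sum n_) : F :=
  z ^+ (\sum_i n %/ n_ i *
    ((y : {dffun forall i, residues (n_ i)}) i *
     (x : {dffun forall i, residues (n_ i)}) i))%N.

Let dvd_n i : (n_ i %| n)%N.
Proof. by rewrite /n (bigD1 i) //= dvdn_mulr. Qed.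

Lemma pairingC y x : pairing y x = pairing x y.
Proof.
by congr (_ ^+ _); apply: eq_bigr => i _; rewrite [(x i * _)%N in RHS]mulnC.
Qed.

(* [z ^+ (n %/ n_ i)] is an [n_ i]-th root of unity. *)
Lemma pairing_modn (y : direct_sum n_) (f : 'I_m -> nat) :
  z ^+ (\sum_i n %/ n_ i *
    ((y : {dffun forall i, residues (n_ i)}) i * (f i %% n_ i)))%N
  = z ^+ (\sum_i n %/ n_ i *
    ((y : {dffun forall i, residues (n_ i)}) i * f i))%N.
Proof.
rewrite -!prodrXr; apply: eq_bigr => i _.
have root_n_ : (z ^+ (n %/ n_ i)) ^+ n_ i = 1.
  by rewrite -exprM divnK // prim_expr_order.
by rewrite ![(y i * _)%N]mulnC !exprM (expr_mod _ root_n_).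
Qed.

Lemma pairingMr y : {morph pairing y : x x' / (x * x')%g >-> x * x'}.
Proof.
move=> x x'; rewrite /pairing -exprD -big_split /=.
under [in RHS]eq_bigr => i _ do rewrite -!mulnDr.
rewrite -[RHS]pairing_modn; congr (_ ^+ _); apply: eq_bigr => i _.
(* The modulus built into [residues (n_ i)] is [(n_ i).-1.+1]. *)
rewrite dffunM /=; congr (_ * (_ * (_ %% _)))%N; exact: prednK.
Qed.

Lemma pairingMl x : {morph pairing^~ x : y y' / (y * y')%g >-> y * y'}.
Proof. by move=> y y'; rewrite !(pairingC _ x) pairingMr. Qed.

Lemma pairing_unity y x : pairing y x ^+ n = 1.
Proof. by rewrite -exprM mulnC exprM (prim_expr_order hz) expr1n. Qed.

Lemma pairing_neq0 y x : pairing y x != 0.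
Proof.
apply: contra_eq_neq (pairing_unity y x) => ->.
by rewrite expr0n gtn_eqF ?(prim_order_gt0 hz) // eq_sym oner_eq0.
Qed.

Lemma pairing_neq1 x : x != 1%g -> exists y, pairing y x != 1.
Proof.
move=> x_neq1.
have [i xi] : exists i, (x : {dffun forall i, residues (n_ i)}) i != 1%g.
  apply/existsP; apply: contraNT x_neq1 => /existsPn x1.
  by apply/eqP/ffunP => i; rewrite oneg_ffun; apply/eqP; rewrite -[_ == _]negbK.
have xi0 : (0 < x i)%N by rewrite lt0n; apply: contraNneq xi => xi0; apply/eqP/val_inj.
have xin : (x i < n_ i)%N by rewrite -[ltnRHS]prednK.
have n_gt1 : (1 < n_ i)%N := leq_ltn_trans xi0 xin.
(* Against the generator of the [i]-th summand the exponent is [n %/ n_ i * x i]; since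
   [0 < x i < n_ i], it is not a multiple of [n]. *)
exists (dfung1 (inZp 1 : residues (n_ i))); rewrite /pairing (bigD1 i) //=.
rewrite dfung1_id big1 => [|j ji]; last first.
  by rewrite dfung1_dflt /= ?mul0n ?muln0 // eq_sym.
rewrite /= modn_small ?prednK // mul1n addn0 -(prim_order_dvd hz).
rewrite -[X in (X %| _)%N](divnK (dvd_n i)) dvdn_pmul2l; last first.
  by rewrite divn_gt0 // dvdn_leq // (prim_order_gt0 hz).
by rewrite gtnNdvd.
Qed.

Lemma card_direct_sum : #|direct_sum n_| = n.
Proof.
rewrite card_dep_ffun foldrE big_map big_enum.
by apply: eq_bigr => i _; rewrite card_ord prednK.
Qed.

Lemma card_direct_sum_neq0 : #|direct_sum n_|%:R != 0 :> F.
Proof. by rewrite card_direct_sum (prim_root_natf_neq0 hz). Qed.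

End Pairing.

(** * Field morphisms and the Galois action on character sums *)

Lemma rmorph_pairing (F E : fieldType) (f : {rmorphism F -> E}) m
    (n_ : 'I_m -> nat) (z : F) (y x : direct_sum n_) :
  f (pairing z y x) = pairing (f z) y x.
Proof. exact: rmorphXn. Qed.

Lemma rmorph_cayley_value (F E : fieldType) (f : {rmorphism F -> E}) m
    (n_ : 'I_m -> nat) (z : F) (S : {set direct_sum n_}) y :
  f (cayley_value S (pairing z y)) = cayley_value S (pairing (f z) y).
Proof. by rewrite rmorph_sum; apply: eq_bigr => s _; apply: rmorph_pairing. Qed.

Section GaloisAction.

Variables (m : nat) (n_ : 'I_m -> nat) (n_gt0 : forall i, (0 < n_ i)%N).
Variables (L : splittingFieldType rat) (zeta : L).
Hypothesis hz : (\prod_i n_ i)%N.-primitive_root zeta.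

(** The power to which [s] raises [zeta] is absorbed into the coordinates of [x], whose reduction
    modulo [n_ i] does not change the pairing. *)
Lemma gal_pairing (s : gal_of {:L}) (y x : direct_sum n_) :
  s (pairing zeta y x) = pairing zeta y (gal_action hz x s).
Proof.
rewrite rmorphXn /= (gal_expP hz) -exprM mulnC big_distrl /=.
under eq_bigr => i _ do rewrite -!mulnA [(x i * _)%N]mulnC.
rewrite -(pairing_modn hz y); congr (_ ^+ _); apply: eq_bigr => i _.
by rewrite ffunE /=; congr (_ * (_ * (_ %% _)))%N; rewrite prednK.
Qed.

Lemma gal_cayley_value (s : gal_of {:L}) (S : {set direct_sum n_}) y :
  s (cayley_value S (pairing zeta y)) =
    cayley_value ((gal_action hz)^*%act S s) (pairing zeta y).
Proof.
rewrite rmorph_sum /cayley_value big_imset /= => [|x x' _ _]; last exact: act_inj.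
by apply: eq_bigr => x _; rewrite gal_pairing.
Qed.

Lemma galois_rat_fullv (K : {subfield L}) : galois K {:L}.
Proof.
rewrite /galois subvf normalFieldf andbT /=.
apply/separableP => x _; apply: pcharf0_separable => p.
by rewrite pchar_lalg Num.Theory.pchar_num.
Qed.

Lemma cayley_value_in_fieldP (K : {subfield L}) (S : {set direct_sum n_}) :
  (forall y, cayley_value S (pairing zeta y) \in K) <->
  [acts 'Gal({:L} / K)%g, on S | gal_action hz].
Proof.
have inK a : reflect (forall s, s \in 'Gal({:L} / K)%g -> s a = a) (a \in K).
  have /galois_fixedField KE := galois_rat_fullv K.
  by rewrite -[in X in reflect _ X]KE; apply: fixedFieldP (memvf a).
split=> [SK | actS y]; last first.
  apply/inK => s sH; rewrite gal_cayley_value.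
  by congr (cayley_value _ _); apply: astabs_setact (subsetP actS s sH).
(* Stability of [S] under [s] means that [S] is a fixed point of the action on subsets, an equality
   of sets that character sums can test. *)
apply/subsetP => s sH; rewrite -astab1_set; apply/astab1P.
apply: (cayley_value_inj (pairingMl n_gt0 hz) (pairingMr n_gt0 hz)
  (pairing_neq1 n_gt0 hz) (pairing_neq0 hz) (card_direct_sum_neq0 n_gt0 hz)).
by move=> y; rewrite -gal_cayley_value; apply: (inK _ (SK y)).
Qed.
End GaloisAction.

(** * Integrality over the subfield and unions of orbits *)

Theorem mainTheorem1 (m : nat) (hm : (0 < m)%N)
    (n_ : 'I_m -> nat) (hn : forall i, (0 < n_ i)%N)
    (L : splittingFieldType rat) (zeta : L)
    (hz : (\prod_i n_ i)%N.-primitive_root zeta)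
    (hL : <<1; zeta>>%VS = {:L}%VS)
    (iota : {rmorphism L -> algC}) (K : {subfield L})
    (S : {set direct_sum n_}) (hS : S \subset [set~ 1%g]) :
  alg_integral_over iota K (cayley_digraph S) <->
  exists2 P : {set {set direct_sum n_}},
    P \subset orbit (gal_action hz) 'Gal({:L} / K)%g @: [set~ 1%g]
    & S = cover P.
Proof.
have hiz : (\prod_i n_ i)%N.-primitive_root (iota zeta).
  by rewrite fmorph_primitive_root.
have specP := cayley_eigenvalueP (pairingMl hn hiz) (pairingMr hn hiz)
  (pairing_neq1 hn hiz) (pairing_neq0 hiz) (card_direct_sum_neq0 hn hiz) S.
set H := 'Gal({:L} / K)%g.
(* Both sides are compared with stability of [S] under [H]. The spectrum lives in [algC], but its
   elements are images under the injective [iota] of character sums in [L]. *)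
apply: (iff_trans (B := [acts H, on S | gal_action hz])).
  apply: iff_trans (cayley_value_in_fieldP hn hz K S); split=> [intS y | SK _ /specP[y ->]].
    have [|_ [k kK]] := intS (cayley_value S (pairing (iota zeta) y)).
      by apply/specP; exists y.
    by rewrite -rmorph_cayley_value => /fmorph_inj->.
  split; last by exists (cayley_value S (pairing zeta y)); rewrite ?rmorph_cayley_value.
  apply: rpred_sum => s _.
  by apply: Aint_unity_root (prim_order_gt0 hz) _; rewrite unity_rootE pairing_unity.
split=> [actS | [P sPorb ->]].
  (* A stable [S] is partitioned by the orbits of its own elements. *)
  exists (orbit (gal_action hz) H @: S); first exact: imsetS.
  exact: esym (cover_partition (orbit_partition actS)).
apply/subsetP => s sH; rewrite !inE; apply/subsetP => x /bigcupP[O OP xO].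
rewrite inE; apply/bigcupP; exists O => //.
have /imsetP[y _ defO] := subsetP sPorb O OP; rewrite defO in xO *.
by rewrite (acts_act (acts_orbit _ _ (subsetT _))).
Qed.
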